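(* Let $G$ be a simple, finite, connected graph and $\{F_1,\ldots,F_k\}$ a c-partition of $E(G)$; let $G_i=G/F_i$. Define $w_i,\lambda_i:V(G_i)\to[0,\infty)$ and $w_i',\lambda_i':E(G_i)\to[0,\infty)$ by: $w_i(X)$ is the number of vertices of the component $X$ of $G\setminus F_i$; $\lambda_i(X)$ is the number of edges of $X$; $w_i'(E)=\sum_{xy\in\widehat{E}}(\deg(x)+\deg(y))$; $\lambda_i'(E)=|\widehat{E}|$. Then $$wSz(G)=\sum_{i=1}^kSz(G_i,w_i,w_i'),\quad wPI_v(G)=\sum_{i=1}^kPI_v(G_i,w_i,w_i'),$$ $$wSz_e(G)=\sum_{i=1}^kSz_t(G_i,\lambda_i,\lambda_i',w_i'),\quad wPI(G)=\sum_{i=1}^k\big(PI_v(G_i,\lambda_i,w_i')+PI(G_i,\lambda_i',w_i')\big).$$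
   Context: $d_H$ is shortest-path distance; for vertex $u$ and edge $f=xy$, $d_H(u,f)=\min\{d_H(u,x),d_H(u,y)\}$. For an edge $e=uv$: $n_u(e)$ is the number of vertices strictly closer to $u$ than to $v$, $m_u(e)$ the number of edges $f$ with $d(u,f)<d(v,f)$. Weighted indices of $G$: $wSz(G)=\sum_{e=uv}(\deg u+\deg v)n_u(e)n_v(e)$, $wPI_v(G)=\sum_{e=uv}(\deg u+\deg v)(n_u(e)+n_v(e))$, $wSz_e(G)=\sum_{e=uv}(\deg u+\deg v)m_u(e)m_v(e)$, $wPI(G)=\sum_{e=uv}(\deg u+\deg v)(m_u(e)+m_v(e))$. For a graph $H$, edge $e=uv$, vertex-weight $w$, edge-weight $\lambda'$: $N_u(e|H)=\{x:d_H(u,x)<d_H(v,x)\}$, $M_u(e|H)=\{f:d_H(u,f)<d_H(v,f)\}$, $n_u(e|(H,w))=\sum_{x\in N_u(e|H)}w(x)$, $m_u(e|(H,\lambda'))=\sum_{f\in M_u(e|H)}\lambda'(f)$. Then $Sz(H,w,w')=\sum_{e=uv}w'(e)n_u(e|(H,w))n_v(e|(H,w))$; $PI_v(H,w,w')=\sum_{e=uv}w'(e)(n_u(e|(H,w))+n_v(e|(H,w)))$; $PI(H,\lambda',w')=\sum_{e=uv}w'(e)(m_u(e|(H,\lambda'))+m_v(e|(H,\lambda')))$; $Sz_t(H,w,\lambda',w')=\sum_{e=uv}w'(e)(n_u(e|(H,w))+m_u(e|(H,\lambda')))(n_v(e|(H,w))+m_v(e|(H,\lambda')))$. Djoković–Winkler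 relation $\Theta$: $u_1v_1\,\Theta\,u_2v_2$ iff $d(u_1,u_2)+d(v_1,v_2)\neq d(u_1,v_2)+d(u_2,v_1)$; $\Theta^*$ its transitive closure; a c-partition is a partition of $E(G)$ each of whose parts is a union of $\Theta^*$-classes. $G/F$: vertices are the components of $G\setminus F$ (edges of $F$ deleted), two adjacent if some vertex of one is adjacent in $G$ to a vertex of the other; for an edge $E=XY$ of $G/F$, $\widehat{E}$ is the set of edges of $G$ joining $X$ and $Y$. *)

(* Defs.v *)
From mathcomp Require Import all_boot all_order all_algebra.

Set Implicit Arguments.
Unset Strict Implicit.
Unset Printing Implicit Defensive.

Import GRing.Theory Num.Theory.

(* Finite simple graphs; an edge uv is the two-element set [set u; v]. *)
Record sgraph := SGraph {
  vertex :> finType;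
  adj : rel vertex;
  adj_sym : symmetric adj;
  adj_irr : irreflexive adj }.

Section Graph.
Variable G : sgraph.
Implicit Types (u x : G) (e f : {set G}).

Definition edges : {set {set G}} :=
  [set e : {set G} | [exists x, exists y, adj x y && (e == [set x; y])]].

Definition connected_graph : Prop := forall x y : G, connect (@adj G) x y.

Definition deg x : nat := #|[set y | adj x y]|.

(* A shortest path has fewer than #|G| edges; the value #|G| is taken only
   when there is no path from x to y. *)
Definition dist x y : nat :=
  \big[minn/#|G|]_(n < #|G|
      | [exists p : n.-tuple G, path (@adj G) x p && (last x p == y)]) n.

Definition dist_edge u f : nat := \big[minn/#|G|]_(x in f) dist u x.

(* When e = [set u; v] with u != v, the only member of e :\ u is v.  An
   expression that is symmetric in the ends of e, such as a_u * a_v or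
   a_u + a_v, is then written as a product or a sum over u in e. *)
Definition closer_vertices u e : {set G} :=
  [set x | [forall v in e :\ u, dist u x < dist v x]].
Definition closer_edges u e : {set {set G}} :=
  [set f in edges | [forall v in e :\ u, dist_edge u f < dist_edge v f]].

Definition wSz : nat :=
  \sum_(e in edges)
    (\sum_(u in e) deg u) * (\prod_(u in e) #|closer_vertices u e|).
Definition wPI_v : nat :=
  \sum_(e in edges)
    (\sum_(u in e) deg u) * (\sum_(u in e) #|closer_vertices u e|).
Definition wSz_e : nat :=
  \sum_(e in edges)
    (\sum_(u in e) deg u) * (\prod_(u in e) #|closer_edges u e|).
Definition wPI : nat :=
  \sum_(e in edges)
    (\sum_(u in e) deg u) * (\sum_(u in e) #|closer_edges u e|).

Section Weighted.
Variable R : realFieldType.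
(* Edge weights are only evaluated on members of edges. *)
Local Open Scope ring_scope.

Definition n_w (w : G -> R) u e : R := \sum_(x in closer_vertices u e) w x.
Definition m_w (l' : {set G} -> R) u e : R := \sum_(f in closer_edges u e) l' f.

Definition Sz (w : G -> R) (w' : {set G} -> R) : R :=
  \sum_(e in edges) w' e * \prod_(u in e) n_w w u e.
Definition PI_v (w : G -> R) (w' : {set G} -> R) : R :=
  \sum_(e in edges) w' e * \sum_(u in e) n_w w u e.
Definition PI (l' w' : {set G} -> R) : R :=
  \sum_(e in edges) w' e * \sum_(u in e) m_w l' u e.
Definition Sz_t (w : G -> R) (l' w' : {set G} -> R) : R :=
  \sum_(e in edges) w' e * \prod_(u in e) (n_w w u e + m_w l' u e).

End Weighted.

(* The inequality is invariant under exchanging the ends of e or of f, so it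
   does not matter how they are named. *)
Definition Theta : rel {set G} := fun e f =>
  [&& e \in edges, f \in edges &
    [exists u1, exists v1, exists u2, exists v2,
      [&& e == [set u1; v1], f == [set u2; v2] &
          dist u1 u2 + dist v1 v2 != dist u1 v2 + dist u2 v1]]].

(* Theta is reflexive on edges, so there its reflexive transitive closure
   [connect Theta] is its transitive closure. *)
Definition Theta_classes : {set {set {set G}}} :=
  equivalence_partition (connect Theta) edges.

Definition c_partition (P : {set {set {set G}}}) : Prop :=
  partition P edges /\
  forall F, F \in P ->
    exists2 S : {set {set {set G}}}, S \subset Theta_classes & F = cover S.

Section Quotient.
Variable F : {set {set G}}.

Definition adj_minus : rel G := fun x y => adj x y && ([set x; y] \notin F).

Definition components : {set {set G}} :=
  equivalence_partition (connect adj_minus) [set: G].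

Definition component := {X : {set G} | X \in components}.

Definition quot_adj : rel component := fun X Y =>
  (X != Y) && [exists x in val X, exists y in val Y, adj x y].

Lemma quot_adj_sym : symmetric quot_adj.
Proof.
move=> X Y; rewrite /quot_adj eq_sym; congr (_ && _).
by apply/existsP/existsP => -[x /andP[xX /existsP[y /andP[yY xy]]]];
  exists y; rewrite yY; apply/existsP; exists x; rewrite xX adj_sym.
Qed.

Lemma quot_adj_irr : irreflexive quot_adj.
Proof. by move=> X; rewrite /quot_adj eqxx. Qed.

Definition quot : sgraph := SGraph quot_adj_sym quot_adj_irr.

Definition hat (E : {set quot}) : {set {set G}} :=
  [set f in edges |
    [exists X in E, exists Y in E :\ X,
      [exists x in val X, exists y in val Y, f == [set x; y]]]].

Section Weights.
Variable R : realFieldType.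
Local Open Scope ring_scope.

Definition wt (X : quot) : R := #|val X|%:R.
Definition lam (X : quot) : R :=
  #|[set f in edges :\: F | f \subset val X]|%:R.
Definition wt' (E : {set quot}) : R :=
  \sum_(f in hat E) \sum_(x in f) (deg x)%:R.
Definition lam' (E : {set quot}) : R := #|hat E|%:R.

End Weights.
End Quotient.
End Graph.

Arguments edges : clear implicits.
Arguments connected_graph : clear implicits.
Arguments wSz : clear implicits.
Arguments wPI_v : clear implicits.
Arguments wSz_e : clear implicits.
Arguments wPI : clear implicits.
Arguments wt {G} F R X.
Arguments lam {G} F R X.
Arguments wt' {G} F R E.
Arguments lam' {G} F R E.

(* Main.v *)
(* Let F be a part of the c-partition.  A geodesic of G has, among all walks
   with the same ends, the fewest steps in F and also the fewest steps outside
   F, because both sets are closed under Theta.  Hence the distance in G / F is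
   the number of F-steps of a geodesic, and d_G splits as this distance plus the
   number of steps outside F; the second term does not change along an edge of
   F.  So an edge uv in F separates the vertices (or edges) of G exactly as its
   image separates their images in G / F, and each index restricted to F is a
   regrouping of sums over the fibres of the projection. *)
Require Import Defs.
From mathcomp Require Import all_boot all_order all_algebra.
From mathcomp Require Import zify.
Import Order.TTheory GRing.Theory Num.Theory.
Local Open Scope ring_scope.

Set Implicit Arguments.
Unset Strict Implicit.
Unset Printing Implicit Defensive.

(** * Minima over finite families, and steps of walks *)

(** The default [K] is not neutral for [minn], so it remains as one more term of the minimum. *)
Lemma leq_bigmin (I : finType) (K m : nat) (P : pred I) (F : I -> nat) :
  (m <= \big[minn/K]_(i | P i) F i)%N =
  (m <= K)%N && [forall (i | P i), (m <= F i)%N].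
Proof.
have seqE r : (m <= \big[minn/K]_(i <- r | P i) F i)%N =
    (m <= K)%N && all (fun i => P i ==> (m <= F i)%N) r.
  elim: r => [|i r IHr]; first by rewrite big_nil andbT.
  by rewrite big_cons /=; case: (P i); rewrite ?leq_min IHr //= andbCA.
rewrite seqE; congr (_ && _).
apply/allP/forall_inP => [H i Pi | H i _]; last exact/implyP/H.
by have := H i; rewrite mem_index_enum Pi; apply.
Qed.

Lemma bigmin_attained (I : finType) (K : nat) (P : pred I) (F : I -> nat) :
  \big[minn/K]_(i | P i) F i = K \/
  exists2 i, P i & \big[minn/K]_(i | P i) F i = F i.
Proof.
apply: (big_ind (fun m => m = K \/ exists2 i, P i & m = F i)); first by left.
  by move=> m n Hm Hn; rewrite /minn; case: ifP.
by move=> i Pi; right; exists i.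
Qed.

(** Steps keep their direction, so that differences of a potential telescope along a walk. *)
Definition steps (T : Type) (x : T) (p : seq T) : seq (T * T) :=
  pairmap pair x p.

Lemma steps_cat (T : Type) (x : T) p q :
  steps x (p ++ q) = steps x p ++ steps (last x p) q.
Proof. exact: pairmap_cat. Qed.

Lemma telescope_steps (T : Type) (g : T -> int) (x : T) p :
  \sum_(s <- steps x p) (g s.2 - g s.1) = g (last x p) - g x.
Proof.
elim: p x => [|y p IHp] x /=; first by rewrite big_nil subrr.
by rewrite big_cons IHp /= addrC addrA subrK.
Qed.

Lemma mem_steps (T : eqType) (x a b : T) p :
  (a, b) \in steps x p ->
  exists p1 p2, p = p1 ++ b :: p2 /\ a = last x p1.
Proof.
elim: p x => [|y p IHp] x //=; rewrite inE => /orP[/eqP[-> ->]|].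
  by exists [::], p.
by move=> /IHp[p1 [p2 [-> ->]]]; exists (y :: p1), p2.
Qed.

Lemma path_steps (T : eqType) (e : rel T) (x a b : T) p :
  path e x p -> (a, b) \in steps x p -> e a b.
Proof.
move=> xp /mem_steps[p1 [p2 [pE ->]]]; move: xp.
by rewrite pE cat_path /= => /and3P[].
Qed.

(** * Distances, geodesics and the relation Theta *)

Section Distance.
Variable G : sgraph.
Implicit Types (a b c d x y z u v : G) (p q : seq G) (e f : {set G}).

Lemma dist_le_size x p : path (@adj G) x p -> (dist x (last x p) <= size p)%N.
Proof.
move=> xp; have := leqnn (dist x (last x p)).
rewrite {2}/dist leq_bigmin => /andP[leG /forall_inP H].
have [ltG|/(leq_trans leG)//] := ltnP (size p) #|G|.
apply: (H (Ordinal ltG)); apply/existsP; exists (in_tuple p).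
by rewrite /= xp eqxx.
Qed.

Lemma dist_le_card x y : (dist x y <= #|G|)%N.
Proof. by have := leqnn (dist x y); rewrite {2}/dist leq_bigmin => /andP[]. Qed.

(** No distance exceeds [#|G|], so the default in [dist_edge] does not affect the minimum. *)
Lemma dist_edgeE u x y :
  dist_edge u [set x; y] = minn (dist u x) (dist u y).
Proof.
apply/eqP; rewrite eq_sym eqn_leq; apply/andP; split.
  rewrite leq_bigmin geq_min dist_le_card /=; apply/forall_inP => z.
  by rewrite !inE geq_min => /orP[]/eqP->; rewrite leqnn ?orbT.
have := leqnn (dist_edge u [set x; y]).
rewrite {2}/dist_edge leq_bigmin => /andP[_ /forall_inP H].
by rewrite leq_min !H // !inE eqxx ?orbT.
Qed.

Lemma dist_edge1 u x : dist_edge u [set x] = dist u x.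
Proof. by rewrite -[[set x]]setUid dist_edgeE minnn. Qed.

Lemma distxx x : dist x x = 0%N.
Proof. by apply/eqP; rewrite -leqn0 (@dist_le_size x [::]). Qed.

Lemma dist_adj x y : adj x y -> (dist x y <= 1)%N.
Proof. by move=> xy; apply: (@dist_le_size x [:: y]); rewrite /= xy. Qed.

Lemma edgesP f : reflect (exists x y, adj x y /\ f = [set x; y]) (f \in edges G).
Proof.
rewrite inE; apply: (iffP existsP) => [[x /existsP[y /andP[xy /eqP->]]]|].
  by exists x, y.
by move=> [x [y [xy ->]]]; exists x; apply/existsP; exists y; rewrite xy eqxx.
Qed.

Lemma edges_set2 x y : adj x y -> [set x; y] \in edges G.
Proof. by move=> xy; apply/edgesP; exists x, y. Qed.

Lemma edges_ends f u v : f \in edges G -> u \in f -> v \in f -> u != v ->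
  adj u v /\ f = [set u; v].
Proof.
move=> /edgesP[x [y [xy ->]]]; rewrite !inE => /orP[]/eqP-> /orP[]/eqP->;
  rewrite ?eqxx // => _.
by rewrite adj_sym setUC.
Qed.

Hypothesis Gconn : connected_graph G.

Lemma geodesicP x y : exists p,
  [/\ path (@adj G) x p, last x p = y & size p = dist x y].
Proof.
have [p xp ->] := connectP (Gconn x y).
have [p' xp' Up' _] := shortenP xp.
(* A path without repeated vertices has fewer than [#|G|] steps, so the minimum in [dist] lies below
   its default and is attained by a walk. *)
have ltG : (size p' < #|G|)%N.
  by rewrite (leq_trans _ (max_card [in x :: p'])) // (card_uniqP Up').
have := leq_ltn_trans (dist_le_size xp') ltG.
case: (@bigmin_attained _ #|G| (fun n : 'I_#|G| => [exists q : n.-tuple G,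
  path (@adj G) x q && (last x q == last x p')]) (fun n => n : nat)).
  by rewrite /dist => ->; rewrite ltnn.
move=> [n /existsP[q /andP[xq /eqP lq]] dE] _; exists q.
by rewrite /dist dE size_tuple.
Qed.

Lemma dist_triangle y x z : (dist x z <= dist x y + dist y z)%N.
Proof.
have [p [xp lp <-]] := geodesicP x y; have [q [yq lq <-]] := geodesicP y z.
have := @dist_le_size x (p ++ q); rewrite cat_path last_cat lp lq xp yq size_cat.
exact.
Qed.

Lemma dist_sym x y : dist x y = dist y x.
Proof.
have le_d (a b : G) : (dist a b <= dist b a)%N.
  have [p [bp lp <-]] := geodesicP b a.
  have := @dist_le_size a (rev (belast b p)).
  rewrite size_rev size_belast -{1}lp rev_path.
  have -> : last a (rev (belast b p)) = b.
    by case: p bp lp => [|c p] _ //= ; rewrite rev_cons last_rcons.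
  by apply; rewrite (eq_path (e' := @adj G)) // => c d; rewrite adj_sym.
by apply/eqP; rewrite eqn_leq !le_d.
Qed.

(** Signed defect in the Djoković-Winkler condition. It is a difference of a potential in the pair
    [u], [v] and also in the pair [x], [y], hence telescopes along walks in either pair. *)
Definition theta x y u v : int :=
  (dist x v)%:Z - (dist x u)%:Z - ((dist y v)%:Z - (dist y u)%:Z).

Lemma theta0 x y u v : adj x y -> adj u v ->
  ~~ Theta [set x; y] [set u; v] -> theta x y u v = 0.
Proof.
move=> xy uv; rewrite /Theta !edges_set2 //=; apply: contraNeq => th.
apply/existsP; exists x; apply/existsP; exists y.
apply/existsP; exists u; apply/existsP; exists v; rewrite !eqxx /=.
apply: contra th => /eqP; rewrite /theta (dist_sym u y) => E; apply/eqP; lia.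
Qed.

(** Each step of a geodesic gains one unit of distance from [x] and loses one unit of distance to
    [y]; the two contributions add up to 2. *)
Lemma geodesic_theta x y q a b : path (@adj G) x q -> last x q = y ->
  size q = dist x y -> (a, b) \in steps x q ->
  (dist a y)%:Z - (dist a x)%:Z - ((dist b y)%:Z - (dist b x)%:Z) = 2%:Z.
Proof.
move=> xq lq sq /mem_steps[q1 [q2 [qE aE]]]; move: xq lq sq.
rewrite {q}qE cat_path last_cat -aE /= size_cat /= => /and3P[xq1 ab bq2] lq sq.
have := dist_le_size xq1; have := dist_le_size bq2; rewrite lq -aE.
have := dist_triangle a x y; have := dist_triangle b x y.
have := dist_triangle b a y; have := dist_triangle a x b.
have := dist_adj ab; rewrite (dist_sym a x) (dist_sym b x); lia.
Qed.

(** * Counting the steps of a walk in a set of edges *)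

Definition crossings (B : {set {set G}}) x p : nat :=
  count (fun s => [set s.1; s.2] \in B) (steps x p).

Definition theta_closed (B : {set {set G}}) :=
  forall e f, e \in B -> Theta e f -> f \in B.

(** This form of closure is symmetric in [B] and its complement, so the crossing bound also applies
    to steps outside [B]. *)
Definition theta_separated (B : {set {set G}}) :=
  forall a b c d, adj a b -> adj c d ->
    ([set a; b] \in B) != ([set c; d] \in B) -> theta a b c d = 0.

Lemma theta_separatedC B : theta_separated B -> theta_separated (~: B).
Proof.
move=> Bs a b c d ab cd neB; apply: Bs => //; move: neB; rewrite !inE.
by do 2!case: (_ \in B).
Qed.

Lemma theta_closed_separated B : theta_closed B -> theta_separated B.
Proof.
move=> Bcl a b c d ab cd.
(* Closure starts from an edge inside [B]; symmetry of [theta] covers the case where that edge is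
   the second one. *)
have thC : theta a b c d = theta c d a b.
  by rewrite /theta (dist_sym c) (dist_sym c) (dist_sym d) (dist_sym d); lia.
have [eB /=|eB] := boolP ([set a; b] \in B); last first.
  case: (boolP ([set c; d] \in B)) => //= fB _.
  rewrite thC; apply: theta0 => //; apply: contra eB; exact: Bcl fB.
move=> fB; apply: theta0 => //; apply: contra fB; exact: Bcl eB.
Qed.

(* Sum theta over the pairs (step of q, step of p) with both steps in B; since
   the mixed terms vanish, either of the two restrictions can be dropped.  Both
   sums then telescope, giving 2 per step of the geodesic q and at most 2 per
   step of the walk p. *)
Lemma geodesic_crossings (B : {set {set G}}) x p q :
  theta_separated B ->
  path (@adj G) x p -> path (@adj G) x q -> last x q = last x p ->
  size q = dist x (last x q) -> (crossings B x q <= crossings B x p)%N.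
Proof.
move=> B0 xp xq lqp sq; set y := last x q in lqp sq.
pose inB (s : G * G) := [set s.1; s.2] \in B.
pose th (s t : G * G) := theta s.1 s.2 t.1 t.2.
have sumB : \sum_(s <- steps x q | inB s) \sum_(t <- steps x p) th s t =
            \sum_(t <- steps x p | inB t) \sum_(s <- steps x q) th s t.
  transitivity
      (\sum_(s <- steps x q | inB s) \sum_(t <- steps x p | inB t) th s t).
    rewrite big_seq_cond [RHS]big_seq_cond; apply: eq_bigr => -[a b].
    move=> /andP[sq' sB]; rewrite [RHS]big_mkcond; apply: eq_big_seq => -[c d] tp.
    case: ifPn => // tB; apply: B0;
      rewrite ?(path_steps xq sq') ?(path_steps xp tp) //.
    by move: sB tB; rewrite /inB /= => -> /negbTE->.
  rewrite exchange_big /= big_seq_cond [RHS]big_seq_cond.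
  apply: eq_bigr => -[c d] /andP[tp tB].
  rewrite big_mkcond; apply: eq_big_seq => -[a b] sq'.
  case: ifPn => // sB; apply/esym/B0;
      rewrite ?(path_steps xq sq') ?(path_steps xp tp) //.
  by move: sB tB; rewrite /inB /= => /negbTE-> ->.
have lhs : \sum_(s <- steps x q | inB s) \sum_(t <- steps x p) th s t =
           (2 * crossings B x q)%N%:Z.
  transitivity (\sum_(s <- steps x q | inB s) (2%:Z : int)).
    rewrite big_seq_cond [RHS]big_seq_cond; apply: eq_bigr => -[a b] /andP[sq' _].
    rewrite -(geodesic_theta xq erefl sq sq') -/y lqp.
    rewrite (eq_bigr (fun t => ((dist a t.2)%:Z - (dist b t.2)%:Z)
      - ((dist a t.1)%:Z - (dist b t.1)%:Z))); last first.
      by move=> t _; rewrite /th /theta /=; lia.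
    rewrite (@telescope_steps _ (fun z => (dist a z)%:Z - (dist b z)%:Z)); lia.
  by rewrite big_const_seq iter_addr_0 /crossings -/inB; lia.
have rhs : \sum_(t <- steps x p | inB t) \sum_(s <- steps x q) th s t <=
           (2 * crossings B x p)%N%:Z.
  apply: (@le_trans _ _ (\sum_(t <- steps x p | inB t) (2%:Z : int))); last first.
    by rewrite big_const_seq iter_addr_0 /crossings -/inB; lia.
  rewrite big_seq_cond [leRHS]big_seq_cond; apply: ler_sum => -[c d] /andP[tp _].
  rewrite (eq_bigr (fun s => ((dist s.2 c)%:Z - (dist s.2 d)%:Z)
    - ((dist s.1 c)%:Z - (dist s.1 d)%:Z))); last first.
    by move=> s _; rewrite /th /theta /=; lia.
  rewrite (@telescope_steps _ (fun z => (dist z c)%:Z - (dist z d)%:Z)) -/y.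
  have cd := path_steps xp tp; have := dist_adj cd.
  have := dist_triangle c x d; have := dist_triangle d y c.
  rewrite (dist_sym d c); lia.
have := rhs; rewrite -sumB lhs; lia.
Qed.

Lemma c_partition_closed P B : c_partition P -> B \in P -> theta_closed B.
Proof.
move=> [_ cP] /cP[S sST ->] e f /bigcupP[A AS eA] ef.
apply/bigcupP; exists A => //.
have /imsetP[e0 _ AE] := subsetP sST A AS.
move: eA; rewrite AE => /setIdP[_ e0e]; apply/setIdP.
have /and3P[_ fE _] := ef; split=> //.
exact: connect_trans e0e (connect1 ef).
Qed.

End Distance.

(** * The projection of G onto G / F *)

Section Quotient.
Variables (G : sgraph) (F : {set {set G}}).
Hypothesis Gconn : connected_graph G.
Hypothesis Fsep : theta_separated F.
Hypothesis Fedges : F \subset edges G.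
Implicit Types (a b u v x y : G) (p q : seq G) (f : {set G}) (X Y : quot F).

Definition proj x : quot F :=
  exist _ [set y in [set: G] | connect (adj_minus F) x y]
    (imset_f (fun x => [set y in [set: G] | connect (adj_minus F) x y])
       (in_setT x)).

Lemma mem_proj x y : (y \in val (proj x)) = connect (adj_minus F) x y.
Proof. by rewrite !inE. Qed.

Lemma connect_adj_minus_sym : connect_sym (adj_minus F).
Proof.
apply: symmetric_from_pre => x y /connectP[p xp ->].
by elim: p x xp => [|z p IHp] x //= /andP[xz /IHp]; move=> zp;
  apply: connect_trans zp (connect1 _); move: xz;
  rewrite /adj_minus adj_sym setUC.
Qed.

Lemma proj_eq x y : (proj x == proj y) = connect (adj_minus F) x y.
Proof.
apply/eqP/idP => [pE | xy]; first by rewrite -mem_proj pE mem_proj connect0.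
apply/val_inj/setP => z; rewrite !mem_proj.
exact: (same_connect connect_adj_minus_sym).
Qed.

Lemma mem_component X x : (x \in val X) = (X == proj x).
Proof.
case: X => S SP; have /imsetP[z _ SE] := SP.
have -> : exist _ S SP = proj z by apply: val_inj.
by rewrite mem_proj proj_eq.
Qed.

Lemma proj_surj X : exists x, X = proj x.
Proof.
case: X => S SP; have /imsetP[z _ SE] := SP.
by exists z; apply: val_inj.
Qed.

Lemma proj_adj x y : adj x y -> [set x; y] \notin F -> proj x = proj y.
Proof. by move=> xy NF; apply/eqP; rewrite proj_eq connect1 // /adj_minus xy. Qed.

Lemma quot_adjP X Y :
  reflect (exists x y, [/\ X = proj x, Y = proj y, X != Y & adj x y])
    (@adj (quot F) X Y).
Proof.
apply: (iffP andP) => [[XY /existsP[x /andP[xX /existsP[y /andP[yY xy]]]]]|].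
  by exists x, y; split=> //; apply/eqP; rewrite -mem_component.
move=> [x [y [XE YE XY xy]]]; split=> //.
apply/existsP; exists x; rewrite mem_component XE eqxx /=.
by apply/existsP; exists y; rewrite mem_component YE eqxx.
Qed.

Lemma proj_adj_or x y : adj x y ->
  proj x = proj y \/ @adj (quot F) (proj x) (proj y).
Proof.
move=> xy; case: (eqVneq (proj x) (proj y)) => [|ne]; [by left | right].
by apply/quot_adjP; exists x, y.
Qed.

Lemma quot_connected : connected_graph (quot F).
Proof.
move=> X Y; have [x ->] := proj_surj X; have [y ->] := proj_surj Y.
have [p xp ->] := connectP (Gconn x y).
elim: p x xp => [|z p IHp] x //= /andP[xz /IHp]; apply: connect_trans.
by case: (proj_adj_or xz) => [->|/connect1].
Qed.

(** * Distances in G / F and the splitting of distances in G *)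

Lemma dist_proj_le x p : path (@adj G) x p ->
  (dist (proj x) (proj (last x p)) <= crossings F x p)%N.
Proof.
elim: p x => [|z p IHp] x /=; first by rewrite distxx.
move=> /andP[xz /IHp]; rewrite /crossings /= => zp.
case: (boolP (_ \in F)) => [_|/(proj_adj xz)->//].
have := dist_triangle quot_connected (proj z) (proj x) (proj (last z p)).
have : (dist (proj x) (proj z) <= 1)%N.
  by case: (proj_adj_or xz) => [->|/dist_adj//]; rewrite distxx.
lia.
Qed.

Lemma lift_component x y : proj x = proj y ->
  exists p, [/\ path (@adj G) x p, last x p = y & crossings F x p = 0%N].
Proof.
move=> /eqP; rewrite proj_eq => /connectP[p xp ->]; exists p.
elim: p x xp => [|z p IHp] x //= /andP[/andP[xz xzF] /IHp[zp _ pF]].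
by split=> //; rewrite ?xz //; move: pF; rewrite /crossings /= (negbTE xzF).
Qed.

(** Every quotient edge comes from an edge [ab] of G, and [a] is reached inside the current
    component at no cost in F-steps. *)
Lemma lift_path x y (P : seq (quot F)) :
  path (@adj (quot F)) (proj x) P -> last (proj x) P = proj y ->
  exists p, [/\ path (@adj G) x p, last x p = y & (crossings F x p <= size P)%N].
Proof.
elim: P x => [|Z P IHP] x /=.
  by move=> _ /lift_component[p [xp lp cp]]; exists p; rewrite cp.
move=> /andP[/quot_adjP[a [b [xa -> _ ab]]] bP] /(IHP _ bP)[q [bq lq cq]].
have [p [xp lp cp]] := lift_component xa.
exists (p ++ b :: q); rewrite cat_path last_cat lp /= xp ab bq; split=> //.
move: cp cq; rewrite /crossings steps_cat count_cat lp /=.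
by case: (_ \in F) => /=; lia.
Qed.

(** Projecting the geodesic gives one inequality. For the other, a geodesic of the quotient lifts to
    a walk with no more F-steps than its length, and [q] has the fewest F-steps. *)
Lemma dist_proj x q : path (@adj G) x q -> size q = dist x (last x q) ->
  dist (proj x) (proj (last x q)) = crossings F x q.
Proof.
move=> xq sq; apply/eqP; rewrite eqn_leq dist_proj_le //=.
have [P [xP lP <-]] := geodesicP quot_connected (proj x) (proj (last x q)).
have [p [xp lp]] := lift_path xP lP.
by apply: leq_trans; apply: geodesic_crossings.
Qed.

Lemma crossingsC x p : crossings (~: F) x p = (size p - crossings F x p)%N.
Proof.
rewrite /crossings -[X in (X - _)%N](size_pairmap pair x).
rewrite -(count_predC (fun s => [set s.1; s.2] \in F)) addKn.
by apply: eq_count => s; rewrite inE.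
Qed.

Lemma crossings_size x p : (crossings F x p <= size p)%N.
Proof. by rewrite -[X in (_ <= X)%N](size_pairmap pair x) count_size. Qed.

(* The number of edges outside F on any geodesic from x to y. *)
Definition codist x y : nat := (dist x y - dist (proj x) (proj y))%N.

(** The truncated subtraction in [codist] is exact: the quotient distance counts some of the steps
    of a geodesic. *)
Lemma dist_split x y : dist x y = (dist (proj x) (proj y) + codist x y)%N.
Proof.
have [q [xq lq sq]] := geodesicP Gconn x y; subst y.
by rewrite /codist subnKC // dist_proj // -sq crossings_size.
Qed.

Lemma codist_le x p : path (@adj G) x p ->
  (codist x (last x p) <= crossings (~: F) x p)%N.
Proof.
have [q [xq lq sq]] := geodesicP Gconn x (last x p).
move=> xp; rewrite -lq in sq.
have := geodesic_crossings Gconn (theta_separatedC Fsep) xp xq lq sq.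
by rewrite crossingsC -(dist_proj xq sq) sq lq.
Qed.

Lemma codist_geodesic x y : exists p,
  [/\ path (@adj G) x p, last x p = y & crossings (~: F) x p = codist x y].
Proof.
have [q [xq lq sq]] := geodesicP Gconn x y; subst y.
by exists q; rewrite crossingsC /codist dist_proj // sq.
Qed.

Lemma codist_sym x y : codist x y = codist y x.
Proof.
by rewrite /codist (dist_sym Gconn) (dist_sym quot_connected (proj x)).
Qed.

(** Prepending an edge of F to a walk leaves its number of steps outside F unchanged; this works
    from either end of the edge. *)
Lemma codistF u v x : adj u v -> [set u; v] \in F -> codist u x = codist v x.
Proof.
have le_c (a b : G) : adj a b -> [set a; b] \in F -> (codist a x <= codist b x)%N.
  move=> ab abF; have [p [bp <- <-]] := codist_geodesic b x.
  have := @codist_le a (b :: p); rewrite /= ab => /(_ bp).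
  by rewrite /crossings /= inE abF.
move=> uv uvF; apply: anti_leq; apply/andP; split.
  by apply: le_c; [exact: uv | exact: uvF].
by apply: le_c; [rewrite adj_sym; exact: uv | rewrite setUC; exact: uvF].
Qed.

Lemma projF_neq u v : adj u v -> [set u; v] \in F -> proj u != proj v.
Proof.
move=> uv uvF; apply: contraL (uv) => /eqP E.
(* If the projections agreed, both terms of the splitting of [dist u v] would vanish, so [u] would
   equal [v]. *)
have := dist_split u v; have := dist_split v v.
rewrite E !distxx (codistF v uv uvF) => <- d0.
have [p [_ lp sp]] := geodesicP Gconn u v.
by move: lp; rewrite (size0nil (etrans sp d0)) /= => ->; rewrite adj_irr.
Qed.

(** * Images of edges, and closer sets in G and in G / F *)

Lemma imset_proj x y : proj @: [set x; y] = [set proj x; proj y].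
Proof. by rewrite imsetU1 imset_set1. Qed.

Lemma proj_edge f : f \in F -> proj @: f \in edges (quot F).
Proof.
move=> fF; have /edgesP[x [y [xy fE]]] := subsetP Fedges f fF.
rewrite fE imset_proj; apply: edges_set2; apply/quot_adjP.
by exists x, y; split=> //; apply: projF_neq => //; rewrite -fE.
Qed.

Lemma proj_nonedge f : f \in edges G -> f \notin F ->
  exists2 X, proj @: f = [set X] & forall Y, (f \subset val Y) = (Y == X).
Proof.
move=> /edgesP[x [y [xy ->]]] NF; exists (proj x).
  by rewrite imset_proj -(proj_adj xy NF) setUid.
by move=> Y; rewrite subUset !sub1set !mem_component -(proj_adj xy NF) andbb.
Qed.

Lemma proj_inj f : f \in F -> {in f &, injective proj}.
Proof.
move=> fF u v uf vf; apply: contra_eq => uv.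
have [auv fE] := edges_ends (subsetP Fedges f fF) uf vf uv.
by apply: projF_neq; rewrite -?fE.
Qed.

(** Only edges of F join distinct components, and every edge of F does; so [hat E] is a fibre of the
    image map on F. *)
Lemma hatE (E : {set quot F}) : E \in edges (quot F) ->
  hat E = [set f in F | proj @: f == E].
Proof.
move=> EE; apply/setP => f; rewrite [RHS]inE; apply/setIdP/andP.
  move=> [fG /existsP[X /andP[XE /existsP[Y /andP[/setD1P[YX YE]]]]]].
  move=> /existsP[x /andP[xX /existsP[y /andP[yY /eqP fE]]]].
  move: xX yY; rewrite !mem_component => /eqP XP /eqP YP.
  have [_ ->] := edges_ends EE YE XE YX.
  rewrite fE imset_proj XP YP (setUC [set proj y]) eqxx; split=> //.
  have xy : x != y by apply: contraNneq YX; rewrite XP YP => ->.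
  have [axy _] : adj x y /\ f = [set x; y].
    by apply: edges_ends fG _ _ xy; rewrite fE !inE eqxx ?orbT.
  by apply: contraNT YX => /(proj_adj axy) pE; rewrite XP YP pE.
move=> [fF /eqP<-]; have fG := subsetP Fedges f fF; split=> //.
have /edgesP[x [y [xy fE]]] := fG.
have pxy : proj x != proj y by apply: projF_neq; rewrite -?fE.
rewrite fE imset_proj.
apply/existsP; exists (proj x); rewrite set21 andTb.
apply/existsP; exists (proj y); rewrite in_setD1 set22 andbT eq_sym pxy andTb.
apply/existsP; exists x; rewrite mem_component eqxx andTb.
by apply/existsP; exists y; rewrite mem_component !eqxx.
Qed.

(** The projection is injective on [f], so the other end of [f] maps to the other end of its
    image. *)
Lemma forall_proj f u (P : pred G) (Q : pred (quot F)) : f \in F -> u \in f ->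
  (forall v, adj u v -> [set u; v] \in F -> P v = Q (proj v)) ->
  [forall v in f :\ u, P v] = [forall V in proj @: f :\ proj u, Q V].
Proof.
move=> fF uf PQ; have fG := subsetP Fedges f fF.
have PQf v : v \in f -> u != v -> P v = Q (proj v).
  by move=> vf uv; have [auv fE] := edges_ends fG uf vf uv; rewrite PQ -?fE.
apply/forall_inP/forall_inP => [H V /setD1P[Vu /imsetP[v vf VE]] | H v].
  have vu : v != u by apply: contraNneq Vu; rewrite VE => ->.
  by rewrite VE -PQf // ?H 1?eq_sym // !inE vu.
move=> /setD1P[vu vf]; rewrite PQf 1?eq_sym // H // !inE imset_f // andbT.
by apply: contraNneq vu => /(proj_inj fF vf uf)->.
Qed.

(** The codistances from [x] to the two ends of [f] agree and cancel in the comparison. *)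
Lemma closer_vertices_proj f u x : f \in F -> u \in f ->
  (x \in closer_vertices u f) =
  (proj x \in closer_vertices (proj u) (proj @: f)).
Proof.
move=> fF uf; rewrite !inE; apply: forall_proj => // v uv uvF.
by rewrite (dist_split u) (dist_split v) (codistF x uv uvF) ltn_add2r.
Qed.

Lemma dist_edge_proj u v f : adj u v -> [set u; v] \in F -> f \in edges G ->
  (dist_edge u f < dist_edge v f)%N =
  (dist_edge (proj u) (proj @: f) < dist_edge (proj v) (proj @: f))%N.
Proof.
move=> uv uvF /edgesP[x [y [xy ->]]]; rewrite imset_proj !dist_edgeE.
rewrite !(dist_split u) !(dist_split v) !(codistF _ uv uvF).
(* For [xy] in F the codistances to [x] and [y] agree; otherwise the quotient distances agree.
   Either way both minima carry the same additive codistance term. *)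
case: (boolP ([set x; y] \in F)) => [xyF | /(proj_adj xy)<-]; last by lia.
by rewrite (codist_sym v x) (codistF v xy xyF) (codist_sym y v); lia.
Qed.

Lemma mem_closer_edges_proj f u g : f \in F -> u \in f -> g \in F ->
  (g \in closer_edges u f) =
  (proj @: g \in closer_edges (proj u) (proj @: f)).
Proof.
move=> fF uf gF; have gG := subsetP Fedges g gF.
rewrite [LHS]in_set [RHS]in_set gG (proj_edge gF) !andTb.
by apply: (forall_proj fF uf) => v uv uvF; apply: dist_edge_proj.
Qed.

(** An edge outside F collapses to a vertex, so its edge distance becomes a vertex distance in the
    quotient. *)
Lemma mem_closer_edges_component f u g X : f \in F -> u \in f ->
  g \in edges G -> proj @: g = [set X] ->
  (g \in closer_edges u f) = (X \in closer_vertices (proj u) (proj @: f)).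
Proof.
move=> fF uf gG gX.
rewrite [LHS]in_set [RHS]in_set gG andTb.
apply: (forall_proj fF uf) => v uv uvF.
by rewrite (dist_edge_proj uv uvF gG) gX !dist_edge1.
Qed.

(** * Weighted indices of G / F as sums over F *)

Section Weights.
Variable R : realFieldType.

(** The closer vertices are grouped by component; a component lies wholly on one side or contributes
    nothing. *)
Lemma n_w_wt f u : f \in F -> u \in f ->
  n_w (G := quot F) (wt F R) (proj u) (proj @: f) = #|closer_vertices u f|%:R.
Proof.
move=> fF uf; rewrite /n_w /wt -natr_sum -sum1_card; congr _%:R.
rewrite [RHS](partition_big proj [in closer_vertices (proj u) (proj @: f)]) /=;
  last by move=> x; rewrite closer_vertices_proj.
apply: eq_bigr => X XC; rewrite -sum1_card; apply: eq_bigl => x.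
rewrite mem_component closer_vertices_proj // eq_sym.
by case: eqP => [->|]; rewrite ?XC ?andbF.
Qed.

Lemma m_w_lam' f u : f \in F -> u \in f ->
  m_w (G := quot F) (lam' F R) (proj u) (proj @: f) =
  #|closer_edges u f :&: F|%:R.
Proof.
move=> fF uf; rewrite /m_w /lam' -natr_sum -sum1_card; congr _%:R.
rewrite [RHS](partition_big (fun g : {set G} => proj @: g)
    [in closer_edges (proj u) (proj @: f)]) /=;
  last by move=> g /setIP[gc gF]; rewrite -mem_closer_edges_proj.
apply: eq_bigr => E EC; have /setIdP[EG _] := EC.
rewrite hatE // -sum1_card; apply: eq_bigl => g; rewrite 2!inE.
case: eqP => [gE|]; rewrite ?andbF // !andbT; case: (boolP (g \in F)) => gF.
  by rewrite mem_closer_edges_proj // gE EC.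
by rewrite andbF.
Qed.

Lemma n_w_lam f u : f \in F -> u \in f ->
  n_w (G := quot F) (lam F R) (proj u) (proj @: f) =
  #|closer_edges u f :\: F|%:R.
Proof.
move=> fF uf; rewrite /n_w /lam -natr_sum; congr _%:R.
under eq_bigr => X _ do rewrite -sum1dep_card big_mkcondr /=.
(* After the exchange, the inner sum runs over the components containing a fixed edge [g]; outside F
   there is exactly one. *)
rewrite exchange_big /= -sum1_card [RHS]big_mkcond [LHS]big_mkcond /=.
apply: eq_bigr => g _; rewrite !in_setD [X in if X then _ else 0%N]andbC.
case: (boolP (g \in edges G)) => gG; last first.
  rewrite (_ : g \in closer_edges u f = false) ?andbF //.
  by apply: contraNF gG => /setIdP[].
case: (boolP (g \in F)) => gF //=.
have [X gX subX] := proj_nonedge gG gF.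
rewrite (mem_closer_edges_component fF uf gG gX) -big_mkcondr.
under eq_bigl => Y do rewrite subX andbC.
by rewrite big_mkcondr big_pred1_eq.
Qed.

Lemma n_w_lamD f u : f \in F -> u \in f ->
  n_w (G := quot F) (lam F R) (proj u) (proj @: f) +
  m_w (G := quot F) (lam' F R) (proj u) (proj @: f) = #|closer_edges u f|%:R.
Proof. by move=> fF uf; rewrite n_w_lam // m_w_lam' // -natrD addnC cardsID. Qed.

(** Common regrouping for all the indices: [wt'] collects the degree sums over the fibre of each
    quotient edge. *)
Lemma sum_wt' (phi : {set quot F} -> R) (psi : {set G} -> R) :
  (forall f, f \in F -> phi (proj @: f) = psi f) ->
  \sum_(E in edges (quot F)) wt' F R E * phi E =
  \sum_(f in F) (\sum_(u in f) deg u)%N%:R * psi f.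
Proof.
move=> phiE; rewrite [RHS](partition_big (fun f : {set G} => proj @: f)
  [in edges (quot F)]) /=; last exact: proj_edge.
apply: eq_bigr => E EG; rewrite /wt' hatE // big_distrl /=.
apply: eq_big => [f|f]; first by rewrite inE.
by move=> /setIdP[fF /eqP<-]; rewrite natr_sum phiE.
Qed.

Lemma Sz_quot : Sz (G := quot F) (wt F R) (wt' F R) =
  \sum_(f in F) ((\sum_(u in f) deg u) *
                 \prod_(u in f) #|closer_vertices u f|)%N%:R.
Proof.
under [RHS]eq_bigr => f _ do rewrite natrM natr_prod.
apply: sum_wt' => f fF; rewrite big_imset /=; last exact: proj_inj.
by apply: eq_bigr => u uf; rewrite n_w_wt.
Qed.

Lemma PI_v_quot : PI_v (G := quot F) (wt F R) (wt' F R) =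
  \sum_(f in F) ((\sum_(u in f) deg u) *
                 \sum_(u in f) #|closer_vertices u f|)%N%:R.
Proof.
under [RHS]eq_bigr => f _ do rewrite natrM [X in _ * X]natr_sum.
apply: sum_wt' => f fF; rewrite big_imset /=; last exact: proj_inj.
by apply: eq_bigr => u uf; rewrite n_w_wt.
Qed.

Lemma Sz_t_quot : Sz_t (G := quot F) (lam F R) (lam' F R) (wt' F R) =
  \sum_(f in F) ((\sum_(u in f) deg u) *
                 \prod_(u in f) #|closer_edges u f|)%N%:R.
Proof.
under [RHS]eq_bigr => f _ do rewrite natrM natr_prod.
apply: sum_wt' => f fF; rewrite big_imset /=; last exact: proj_inj.
by apply: eq_bigr => u uf; rewrite n_w_lamD.
Qed.

Lemma PI_quot : PI_v (G := quot F) (lam F R) (wt' F R) +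
    PI (G := quot F) (lam' F R) (wt' F R) =
  \sum_(f in F) ((\sum_(u in f) deg u) *
                 \sum_(u in f) #|closer_edges u f|)%N%:R.
Proof.
under [RHS]eq_bigr => f _ do rewrite natrM [X in _ * X]natr_sum.
(* Both indices carry the weight [wt'], so they merge, and edges inside and outside F are counted
   together. *)
rewrite /PI_v /PI -big_split /=; under eq_bigr => E _ do rewrite -mulrDr.
apply: sum_wt' => f fF; rewrite -big_split big_imset /=; last exact: proj_inj.
by apply: eq_bigr => u uf; rewrite n_w_lamD.
Qed.

End Weights.
End Quotient.

(** * Summation over the parts of the c-partition *)

Lemma sum_edges_partition (R : realFieldType) (G : sgraph) (k : nat)
    (F : 'I_k -> {set {set G}}) (g : {set G} -> nat) :
  injective F -> partition [set F i | i : 'I_k] (edges G) ->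
  (\sum_(f in edges G) g f)%N%:R = \sum_(i < k) \sum_(f in F i) (g f)%:R :> R.
Proof.
move=> Finj /and3P[/eqP <- tP _]; rewrite natr_sum big_trivIset //=.
(* Injectivity of [F] turns the sum over the set of parts into a sum over indices. *)
by rewrite big_imset //= => i j _ _; apply: Finj.
Qed.

Theorem theorem3p5 (R : realFieldType) (G : sgraph) (k : nat)
    (F : 'I_k -> {set {set G}})
    (Gconn : connected_graph G)
    (Finj : injective F)
    (Fcpart : c_partition [set F i | i : 'I_k]) :
  [/\ (wSz G)%:R = \sum_(i < k) Sz (G := quot (F i)) (wt (F i) R) (wt' (F i) R),
      (wPI_v G)%:R = \sum_(i < k) PI_v (G := quot (F i)) (wt (F i) R) (wt' (F i) R),
      (wSz_e G)%:R =
        \sum_(i < k) Sz_t (G := quot (F i)) (lam (F i) R) (lam' (F i) R) (wt' (F i) R)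
    & (wPI G)%:R =
        \sum_(i < k) (PI_v (G := quot (F i)) (lam (F i) R) (wt' (F i) R)
                      + PI (G := quot (F i)) (lam' (F i) R) (wt' (F i) R))].
Proof.
have Fpart := Fcpart.1.
have Fsep i : theta_separated (F i).
  apply: (theta_closed_separated Gconn); apply: (c_partition_closed Fcpart).
  exact: imset_f.
have FG i : F i \subset edges G.
  by rewrite -(cover_partition Fpart) (bigcup_sup (F i)) // imset_f.
by split; rewrite (sum_edges_partition R _ Finj Fpart); apply: eq_bigr => i _;
  rewrite ?Sz_quot ?PI_v_quot ?Sz_t_quot ?PI_quot.
Qed.
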